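(* Let $n\ge 1$, let $\mathbb{C}_*^n=\{(z_1,\dots,z_n)\in\mathbb{C}^n \mid i\neq j\Rightarrow z_i\neq z_j\}$, and let the symmetric group $\mathfrak{S}_n$ act on $\mathbb{C}_*^n$ by permutation of coordinates. Let $U$ be any finite-dimensional complex vector space equipped with a linear action of $\mathfrak{S}_n$, and let $\mathfrak{S}_n$ act diagonally on $\mathbb{C}_*^n\times U$. Then the quotient complex vector bundle $(\mathbb{C}_*^n\times U)/\mathfrak{S}_n\to \mathbb{C}_*^n/\mathfrak{S}_n$ (a Knizhnik-Zamolodchikov bundle) is topologically trivial.
   Context: A Knizhnik-Zamolodchikov bundle (KZ-bundle) is a complex vector bundle over $\mathbb{C}_*^n/\mathfrak{S}_n$ of the form $(\mathbb{C}_*^n\times U\to\mathbb{C}_*^n)/\mathfrak{S}_n$, i.e. the quotient of the trivial bundle $\mathbb{C}_*^n\times U\to\mathbb{C}_*^n$ by the diagonal action of $\mathfrak{S}_n$, where $U$ is a finite-dimensional complex linear representation of $\mathfrak{S}_n$. Topologically trivial means isomorphic, as a topological complex vector bundle, to a product bundle. *)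

(* Defs.v *)
From HB Require Import structures.
From mathcomp Require Import all_boot all_order all_algebra all_fingroup.
From mathcomp Require Import complex.
From mathcomp Require Import all_classical all_reals topology normedtype.

Set Implicit Arguments.
Unset Strict Implicit.
Unset Printing Implicit Defensive.

Import Order.TTheory GRing.Theory Num.Theory.
Import numFieldNormedType.Exports VectorInternalTheory.

Local Open Scope classical_set_scope.
Local Open Scope ring_scope.

Definition complexes (R : realType) : numClosedFieldType := R[i].

(* V with its canonical topology, transported from K^(dim V) by the coordinate
   isomorphism v2r; linear_continuous below shows that the choice of
   coordinates is immaterial. *)
Definition vtop (K : numFieldType) (V : vectType K) : Type := V.

HB.instance Definition _ (K : numFieldType) (V : vectType K) :=
  Vector.copy (vtop V) V.
HB.instance Definition _ (K : numFieldType) (V : vectType K) :=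
  Topological.copy (vtop V) (initial_topology (v2r : V -> 'rV[K]_(dim V))).

Lemma mx_continuous_at (T S : topologicalType) (m n : nat)
    (f : T -> 'M[S]_(m, n)) (x : T) :
  (forall i j, {for x, continuous (fun t => f t i j)}) -> {for x, continuous f}.
Proof.
move=> cf A [P Pn PA].
have : \forall t \near x, forall ij : 'I_m * 'I_n, P ij.1 ij.2 (f t ij.1 ij.2).
  by apply: filter_forall => -[i j]; apply: cf; exact: Pn.
by apply: filterS => t Pt; apply: PA => i j; exact: (Pt (i, j)).
Qed.

Lemma initial_continuous_at (S : choiceType) (T X : topologicalType)
    (f : S -> T) (g : X -> initial_topology f) (x : X) :
  {for x, continuous (f \o g)} -> {for x, continuous g}.
Proof.
move=> cfg A; rewrite {1}nbhsE => -[_ [[B oB <-] Bx] BA].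
have BF : nbhs x ((f \o g) @^-1` B) by apply: cfg; apply: open_nbhs_nbhs.
have : nbhs x (g @^-1` A) by apply: (filterS _ BF) => y; exact: BA.
by [].
Qed.

Lemma sum_continuous_at (K : numFieldType) (T : topologicalType) (I : Type)
    (r : seq I) (f : I -> T -> K) (x : T) :
  (forall i, {for x, continuous (f i)}) ->
  {for x, continuous (fun t => \sum_(i <- r) f i t)}.
Proof.
move=> cf; elim: r => [|i r IHr].
  have -> : (fun t => \sum_(i <- [::]) f i t) = cst 0.
    by apply/funext => t; rewrite big_nil.
  exact: cvg_cst.
have -> : (fun t => \sum_(j <- i :: r) f j t)
    = f i \+ (fun t => \sum_(j <- r) f j t).
  by apply/funext => t; rewrite big_cons.
by apply: cvgD; [exact: cf | exact: IHr].
Qed.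

Lemma linear_continuous (K : numFieldType) (V V' : vectType K) (f : V -> V') :
  linear f -> continuous (f : vtop V -> vtop V').
Proof.
move=> lf v; apply: initial_continuous_at.
pose F : {linear V -> V'} := HB.pack f (GRing.isLinear.Build _ _ _ _ f lf).
pose M := lin1_mx (v2r \o F \o r2v).
have -> : v2r \o f = (fun w => v2r w *m M) :> (V -> _).
  by apply/funext => w; rewrite /M mul_rV_lin1 /= v2rK.
apply: mx_continuous_at => i j.
rewrite (_ : (fun t => _) = fun w : vtop V => \sum_k v2r w i k * M k j); last first.
  by apply/funext => t; rewrite mxE.
apply: sum_continuous_at => k.
have c1 : {for v, continuous (v2r : vtop V -> 'rV[K]_(dim V))}.
  exact: initial_continuous.
have c2 : {for v, continuous (fun w : vtop V => v2r w i k)}.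
  exact: (continuous_comp c1 (@coord_continuous K _ _ i k _)).
exact: (continuousM c2 (@cst_continuous (vtop V) K (M k j) v)).
Qed.

Record vector_bundle (K : numFieldType) (B : topologicalType) := VectorBundle {
  total :> topologicalType;
  proj : total -> B;
  fibre : B -> vectType K;
  (* the vector space structure of the fibre over b is the one making
     [fibre_in b] an isomorphism onto [proj @^-1` [set b]] *)
  fibre_in : forall b, fibre b -> total;
  proj_continuous : continuous proj;
  fibre_in_inj : forall b, injective (@fibre_in b);
  fibre_in_range : forall b, range (@fibre_in b) = proj @^-1` [set b];
  locally_trivial : forall b, exists (W : set B) (V : vectType K)
      (phi : total -> vtop V) (psi : B * vtop V -> total),
    [/\ open W, W b,
        forall e, W (proj e) -> {for e, continuous phi},
        forall p, W p.1 -> {for p, continuous psi} &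
    [/\ forall e, W (proj e) -> psi (proj e, phi e) = e,
        forall p, W p.1 -> proj (psi p) = p.1 /\ phi (psi p) = p.2 &
        forall c, W c -> linear (fun x : fibre c => phi (fibre_in x) : V)]]
}.

Definition bundle_isomorphic (K : numFieldType) (B : topologicalType)
    (E E' : vector_bundle K B) : Prop :=
  exists (f : E -> E') (g : E' -> E),
    [/\ continuous f, continuous g, cancel f g, cancel g f &
    [/\ forall e, proj (f e) = proj e &
        forall b, exists L : {linear fibre E b -> fibre E' b},
          forall x, f (fibre_in x) = fibre_in (L x)]].

Section ProductBundle.
Variables (K : numFieldType) (B : topologicalType) (V : vectType K).

Let fibre_in_prod (b : B) (v : V) : B * vtop V := (b, v).

Lemma product_bundle_in_inj b : injective (fibre_in_prod b).
Proof. by move=> v w []. Qed.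

Lemma product_bundle_in_range b :
  range (fibre_in_prod b) = (fst : B * vtop V -> B) @^-1` [set b].
Proof.
apply/seteqP; split=> [_ [v _ <-]//|[c v] /= ->].
by exists v.
Qed.

Lemma product_bundle_loc (b : B) : exists (W : set B) (V' : vectType K)
    (phi : B * vtop V -> vtop V') (psi : B * vtop V' -> B * vtop V),
  [/\ open W, W b,
      forall e, W e.1 -> {for e, continuous phi},
      forall p, W p.1 -> {for p, continuous psi} &
  [/\ forall e, W e.1 -> psi (e.1, phi e) = e,
      forall p, W p.1 -> (psi p).1 = p.1 /\ phi (psi p) = p.2 &
      forall c, W c -> linear (fun x : V => phi (fibre_in_prod c x) : V')]].
Proof.
exists setT, V, snd, id; split=> //; first exact: openT.
- by move=> e _; exact: cvg_snd.
- by move=> p _; exact: cvg_id.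
by split=> // -[].
Qed.

Definition product_bundle : vector_bundle K B :=
  @VectorBundle K B (B * vtop V)%type fst (fun=> V) fibre_in_prod
    (fun p => @cvg_fst _ _ _ _ _) product_bundle_in_inj product_bundle_in_range
    product_bundle_loc.

End ProductBundle.

Definition topologically_trivial (K : numFieldType) (B : topologicalType)
    (E : vector_bundle K B) : Prop :=
  exists V : vectType K, bundle_isomorphic E (product_bundle B V).

Section TotalActionTheory.
Variables (aT : finGroupType) (T : Type) (to : {action aT &-> T}).

(* action.v states these for finite T only *)
Lemma total_actM x s t : to x (s * t)%g = to (to x s) t.
Proof. by case: to => f /= [_ fM]; rewrite fM ?inE. Qed.

Lemma total_act1 x : to x 1%g = x.
Proof.
have to_inj : injective (to^~ 1%g) by case: to => f /= [f_inj _]; exact: f_inj.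
by apply: to_inj; rewrite -total_actM mulg1.
Qed.

Lemma total_actK s : cancel (to^~ s) (to^~ s^-1%g).
Proof. by move=> x; rewrite -total_actM mulgV total_act1. Qed.

Lemma total_actKV s : cancel (to^~ s^-1%g) (to^~ s).
Proof. by move=> x; rewrite -total_actM mulVg total_act1. Qed.

End TotalActionTheory.

Section OrbitSpace.
Variables (aT : finGroupType) (T : topologicalType) (to : {action aT &-> T}).

Definition same_orbit : rel T := fun x y => [exists s, to x s == y].

Lemma same_orbitP x y : reflect (exists s, to x s = y) (same_orbit x y).
Proof. by apply: (iffP existsP) => -[s /eqP]; exists s => //; apply/eqP. Qed.

Lemma same_orbit_equiv : equiv_class_of same_orbit.
Proof.
split=> [x|x y|y x z].
- by apply/same_orbitP; exists 1%g; exact: total_act1.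
- by apply/same_orbitP/same_orbitP => -[s <-]; exists s^-1%g; exact: total_actK.
- move=> /same_orbitP[s <-] /same_orbitP[t <-].
  by apply/same_orbitP; exists (s * t)%g; exact: total_actM.
Qed.

Canonical same_orbit_equiv_rel := EquivRelPack same_orbit_equiv.

Definition orbit_space : topologicalType :=
  quotient_topology {eq_quot same_orbit_equiv_rel}%qT.

Definition orbit_pi (x : T) : orbit_space :=
  (\pi_(quotient_topology {eq_quot same_orbit_equiv_rel}) x)%qT.

Definition orbit_repr (b : orbit_space) : T :=
  generic_quotient.repr (b : quotient_topology {eq_quot same_orbit_equiv_rel}%qT).

Lemma orbit_reprK : cancel orbit_repr orbit_pi.
Proof. exact: generic_quotient.reprK. Qed.

Lemma orbit_piP x y : orbit_pi x = orbit_pi y <-> exists s, to x s = y.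
Proof.
split=> [/eqmodP/same_orbitP//|H].
by apply/eqmodP/same_orbitP.
Qed.

Lemma orbit_pi_act x s : orbit_pi (to x s) = orbit_pi x.
Proof. by apply/esym/orbit_piP; exists s. Qed.

Lemma orbit_repr_pi x : exists s, orbit_repr (orbit_pi x) = to x s.
Proof.
by have /esym/orbit_piP[s <-] := orbit_reprK (orbit_pi x); exists s.
Qed.

Lemma orbit_pi_continuous : continuous orbit_pi.
Proof. exact: pi_continuous. Qed.

Hypothesis to_continuous : forall s, continuous (to^~ s).

Lemma orbit_pi_open (A : set T) : open A -> open (orbit_pi @` A).
Proof.
move=> oA; rewrite /open /= /quotient_open.
rewrite (_ : _ @^-1` _ = \bigcup_s (to^~ s @^-1` A)).
  by apply: bigcup_open => s _; apply: open_comp => // x _; exact: to_continuous.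
apply/seteqP; split=> [x [y Ay /esym/orbit_piP[s xy]]|x [s _ Axs]].
  by exists s; rewrite //= xy.
by exists (to x s) => //; exact: orbit_pi_act.
Qed.

Lemma orbit_pi_nbhs (A : set T) x : nbhs x A -> nbhs (orbit_pi x) (orbit_pi @` A).
Proof.
rewrite {1}nbhsE => -[B [oB Bx] BA].
have : nbhs (orbit_pi x) (orbit_pi @` B).
  by apply: open_nbhs_nbhs; split; [exact: orbit_pi_open | exists x].
by apply: filterS; exact: image_subset.
Qed.

Lemma orbit_continuous_at (Z : topologicalType) (f : orbit_space -> Z) (x : T) :
  {for x, continuous (f \o orbit_pi)} -> {for orbit_pi x, continuous f}.
Proof.
move=> cf A Afx; have /orbit_pi_nbhs : nbhs x ((f \o orbit_pi) @^-1` A) by exact: cf.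
by apply: filterS => _ [y Ay <-].
Qed.

Lemma orbit_continuous2_at (S Z : topologicalType) (f : orbit_space * S -> Z)
    (x : T) (y : S) :
  {for (x, y), continuous (fun p : T * S => f (orbit_pi p.1, p.2))} ->
  {for (orbit_pi x, y), continuous f}.
Proof.
move=> cf A Af.
have [[P Q] [/= Px Qy] PQ] :
  nbhs (x, y) ((fun p : T * S => f (orbit_pi p.1, p.2)) @^-1` A) by exact: cf.
exists (orbit_pi @` P, Q); first by split=> //; exact: orbit_pi_nbhs.
by move=> [_ v] [/= [u Pu <-] Qv]; exact: (PQ (u, v)).
Qed.

End OrbitSpace.

Section QuotientBundle.
Variables (K : numFieldType) (aT : finGroupType) (X : topologicalType).
Variables (toX : {action aT &-> X}) (U : vectType K) (toU : {action aT &-> U}).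

Definition diag_fun (p : X * vtop U) (s : aT) : X * vtop U :=
  (toX p.1 s, toU p.2 s).

Lemma diag_fun1 : diag_fun^~ 1%g =1 id.
Proof. by case=> x u; rewrite /diag_fun !total_act1. Qed.

Lemma diag_funM p : act_morph diag_fun p.
Proof. by move=> s t; rewrite /diag_fun !total_actM. Qed.

Definition diag_action : {action aT &-> (X * vtop U)%type} :=
  TotalAction diag_fun1 diag_funM.

Definition quotient_proj (e : orbit_space diag_action) : orbit_space toX :=
  orbit_pi toX (orbit_repr e).1.

(* By [quotient_fibre_linear] below, the linear structure that this puts on
   the fibre over b does not depend on the representative of b. *)
Definition quotient_fibre_in (b : orbit_space toX) (u : U) :
    orbit_space diag_action :=
  orbit_pi diag_action (orbit_repr b, u).

Lemma quotient_proj_pi p :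
  quotient_proj (orbit_pi diag_action p) = orbit_pi toX p.1.
Proof.
by rewrite /quotient_proj; have [s ->] := orbit_repr_pi diag_action p;
   exact: orbit_pi_act.
Qed.

Hypothesis toU_linear : forall s, linear (toU^~ s).
Hypothesis toX_continuous : forall s, continuous (toX^~ s).
Hypothesis toX_free : forall x s, toX x s = x -> s = 1%g.
Hypothesis X_separated : hausdorff_space X.

Lemma diag_action_continuous s : continuous (diag_action^~ s).
Proof.
move=> [x u].
have c1 : {for (x, u), continuous (fun p : X * vtop U => toX p.1 s)}.
  have f1 : {for (x, u), continuous (fst : X * vtop U -> X)} by exact: cvg_fst.
  exact: (continuous_comp f1 (@toX_continuous s _)).
have c2 : {for (x, u), continuous (fun p : X * vtop U => toU p.2 s : vtop U)}.
  have f2 : {for (x, u), continuous (snd : X * vtop U -> vtop U)} by exact: cvg_snd.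
  exact: (continuous_comp f2 (@linear_continuous _ _ _ _ (toU_linear s) _)).
exact: (cvg_pair c1 c2).
Qed.

Lemma quotient_proj_continuous : continuous quotient_proj.
Proof.
move=> e; rewrite -[e]orbit_reprK.
apply: orbit_continuous_at; first exact: diag_action_continuous.
rewrite (_ : _ \o _ = orbit_pi toX \o fst); last first.
  by apply/funext => p; exact: quotient_proj_pi.
apply: continuous_comp; first exact: cvg_fst.
exact: orbit_pi_continuous.
Qed.

Lemma quotient_fibre_in_inj b : injective (@quotient_fibre_in b).
Proof.
move=> u v /orbit_piP[s [/toX_free -> <-]].
by rewrite total_act1.
Qed.

Lemma quotient_fibre_in_range b :
  range (@quotient_fibre_in b) = quotient_proj @^-1` [set b].
Proof.
apply/seteqP; split=> [_ [u _ <-]|e /= eb].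
  by rewrite /= quotient_proj_pi orbit_reprK.
have /orbit_piP[s xs] : orbit_pi toX (orbit_repr e).1 = orbit_pi toX (orbit_repr b).
  by rewrite orbit_reprK.
exists (toU (orbit_repr e).2 s) => //.
rewrite -[RHS]orbit_reprK; apply/esym/orbit_piP; exists s.
by rewrite -xs.
Qed.

Lemma quotient_fibre_linear (x : X) : exists L : {linear U -> U},
  forall u, orbit_pi diag_action (x, u) = quotient_fibre_in (orbit_pi toX x) (L u).
Proof.
have [s xs] := orbit_repr_pi toX x.
pose L : {linear U -> U} :=
  HB.pack (toU^~ s) (GRing.isLinear.Build _ _ _ _ _ (toU_linear s)).
exists L => u.
by apply/orbit_piP; exists s; rewrite /= /diag_fun -xs.
Qed.

Lemma disjoint_translates (x : X) : exists V : set X,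
  [/\ open V, V x & forall y s, V y -> V (toX y s) -> s = 1%g].
Proof.
have X_sep : _ := X_separated; rewrite open_hausdorff in X_sep.
have sep s : exists AB : set X * set X, [/\ open AB.1, open AB.2, AB.1 x, AB.2 (toX x s) &
    s != 1%g -> AB.1 `&` AB.2 = set0].
  have [->|s1] := eqVneq s 1%g.
    by exists (setT, setT); split => //; exact: openT.
  have xxs : x != toX x s by apply/eqP => /esym/toX_free/eqP; apply/negP.
  have [AB [xA xB] [oA oB /eqP AB0]] := X_sep _ _ xxs.
  by exists AB; split=> //; [rewrite -inE | rewrite -inE].
have [AB ABP] := choice sep.
exists (\bigcap_s ((AB s).1 `&` (toX^~ s @^-1` (AB s).2))); split.
- rewrite openE => y Vy; rewrite /interior.
  have : \forall z \near y, forall s : aT, ((AB s).1 `&` (toX^~ s @^-1` (AB s).2)) z.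
    apply: filter_forall => s; have [oA oB _ _ _] := ABP s.
    have [Ay By] := Vy s I.
    apply: filterI; first exact: open_nbhs_nbhs.
    by apply: toX_continuous; apply: open_nbhs_nbhs.
  by apply: filterS => z Vz s _; exact: Vz.
- by move=> s _; have [_ _ ? ? _] := ABP s.
move=> y s Vy Vys; apply/eqP; apply: contraT => s1.
have [_ _ _ _ /(_ s1) AB0] := ABP s.
have : ((AB s).1 `&` (AB s).2) (toX y s).
  by split; [have [] := Vys s I | have [] := Vy s I].
by rewrite AB0.
Qed.

Lemma quotient_bundle_loc (b : orbit_space toX) :
  exists (W : set (orbit_space toX)) (V : vectType K)
      (phi : orbit_space diag_action -> vtop V)
      (psi : orbit_space toX * vtop V -> orbit_space diag_action),
    [/\ open W, W b,
        forall e, W (quotient_proj e) -> {for e, continuous phi},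
        forall p, W p.1 -> {for p, continuous psi} &
    [/\ forall e, W (quotient_proj e) -> psi (quotient_proj e, phi e) = e,
        forall p, W p.1 -> quotient_proj (psi p) = p.1 /\ phi (psi p) = p.2 &
        forall c, W c ->
          linear (fun x : U => phi (quotient_fibre_in c x) : V)]].
Proof.
have [V [oV Vb Vdisj]] := disjoint_translates (orbit_repr b).
pose sat := [set x | exists s, V (toX x s)].
pose sel x : aT := xget 1%g [set s | V (toX x s)].
have selP x : sat x -> V (toX x (sel x)).
  by move=> [s Vs]; have := @xgetPex _ 1%g [set s | V (toX x s)]; apply; exists s.
have sel_eq x s : V (toX x s) -> sel x = s.
  move=> Vs; have Vsel : V (toX x (sel x)) by apply: selP; exists s.
  have : (s^-1 * sel x)%g = 1%g.
    by apply: Vdisj Vs _; rewrite -total_actM mulKVg.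
  by move/(canRL (mulKVg _)); rewrite mulg1.
have sat_act x s : sat x -> sat (toX x s).
  by move=> [t Vt]; exists (s^-1 * t)%g; rewrite -total_actM mulKVg.
have sel_act x s : sat x -> sel (toX x s) = (s^-1 * sel x)%g.
  by move=> /selP Vx; apply: sel_eq; rewrite -total_actM mulKVg.
have sat_open : open sat.
  rewrite (_ : sat = \bigcup_s (toX^~ s @^-1` V)).
    by apply: bigcup_open => s _; exact: open_comp.
  by apply/seteqP; split=> x => [[s Vs]|[s _ Vs]]; exists s.
pose W : set (orbit_space toX) := orbit_pi toX @` sat.
have W_pi x : W (orbit_pi toX x) -> sat x.
  by move=> [y sy /orbit_piP[s <-]]; exact: sat_act.
pose phi (e : orbit_space diag_action) : vtop U :=
  toU (orbit_repr e).2 (sel (orbit_repr e).1).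
pose psi (p : orbit_space toX * vtop U) : orbit_space diag_action :=
  orbit_pi diag_action
    (orbit_repr p.1, toU p.2 (sel (orbit_repr p.1))^-1%g).
have phi_pi p : sat p.1 -> phi (orbit_pi diag_action p) = toU p.2 (sel p.1).
  move=> sp; rewrite /phi; have [s ->] := orbit_repr_pi diag_action p.
  by rewrite /= sel_act // -total_actM mulKVg.
have psi_pi x v : sat x ->
    psi (orbit_pi toX x, v) = orbit_pi diag_action (x, toU v (sel x)^-1%g).
  move=> sx; rewrite /psi /=; have [s ->] := orbit_repr_pi toX x.
  apply/esym/orbit_piP; exists s; rewrite /= /diag_fun /=.
  by rewrite sel_act // invMg invgK total_actM.
have near_sel x : sat x -> \forall y \near x, sat y /\ sel y = sel x.
  move=> sx.
  have : nbhs x (toX^~ (sel x) @^-1` V).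
    have Vn : nbhs (toX x (sel x)) V.
      by apply: open_nbhs_nbhs; split=> //; exact: selP.
    exact: (@toX_continuous (sel x) x _ Vn).
  by apply: filterS => y Vy; split; [exists (sel x) | exact: sel_eq].
have near_sel1 (S : topologicalType) x (v : S) : sat x ->
    \forall p \near (x, v), sat p.1 /\ sel p.1 = sel x.
  move=> /near_sel; have := @cvg_fst _ _ (nbhs x) (nbhs v) _; apply.
exists W, U, phi, psi; split.
- exact: orbit_pi_open.
- exists (orbit_repr b); last exact: orbit_reprK.
  by exists 1%g; rewrite total_act1.
- move=> e; rewrite -[e]orbit_reprK; case: (orbit_repr e) => x u.
  rewrite quotient_proj_pi => /W_pi sx.
  apply: orbit_continuous_at; first exact: diag_action_continuous.
  have snd_at : {for (x, u), continuous (snd : X * vtop U -> vtop U)}.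
    exact: cvg_snd.
  have cU : {for (x, u), continuous
      (fun p : X * vtop U => toU p.2 (sel x) : vtop U)}.
    exact: (continuous_comp snd_at
      (@linear_continuous _ _ _ _ (toU_linear (sel x)) _)).
  move: cU; rewrite /prop_for /continuous_at /= phi_pi //.
  apply: cvg_trans; apply: near_eq_cvg.
  by apply: filterS (near_sel1 _ x u sx) => p [sp <-]; rewrite /= phi_pi.
- move=> [c v]; rewrite -[c]orbit_reprK; set x := orbit_repr c => /= /W_pi sx.
  apply: orbit_continuous2_at; first exact: toX_continuous.
  have fst_at : {for (x, v), continuous (fst : X * vtop U -> X)}.
    exact: cvg_fst.
  have snd_at : {for (x, v), continuous (snd : X * vtop U -> vtop U)}.
    exact: cvg_snd.
  have cU : {for (x, v), continuous
      (fun p : X * vtop U => toU p.2 (sel x)^-1%g : vtop U)}.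
    exact: (continuous_comp snd_at
      (@linear_continuous _ _ _ _ (toU_linear (sel x)^-1%g) _)).
  have cp : {for (x, v), continuous (fun p : X * vtop U =>
      (p.1, toU p.2 (sel x)^-1%g) : X * vtop U)}.
    exact: (cvg_pair fst_at cU).
  have cpi := continuous_comp cp (@orbit_pi_continuous _ _ diag_action _).
  move: cpi; rewrite /prop_for /continuous_at /= psi_pi //.
  apply: cvg_trans; apply: near_eq_cvg.
  by apply: filterS (near_sel1 _ x v sx) => p [sp <-]; rewrite /= psi_pi.
split.
- move=> e; rewrite -[e]orbit_reprK; case: (orbit_repr e) => x u.
  rewrite quotient_proj_pi /= => /W_pi sx.
  by rewrite phi_pi // psi_pi // total_actK.
- move=> [c v]; rewrite -[c]orbit_reprK /= => /W_pi sx.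
  by rewrite psi_pi // quotient_proj_pi phi_pi //= total_actKV.
- move=> c; rewrite -[c]orbit_reprK => /W_pi sx k u v.
  rewrite /quotient_fibre_in orbit_reprK.
  by rewrite !phi_pi //=; exact: toU_linear.
Qed.

Definition quotient_bundle : vector_bundle K (orbit_space toX) :=
  @VectorBundle K (orbit_space toX) (orbit_space diag_action) quotient_proj
    (fun=> U) quotient_fibre_in quotient_proj_continuous quotient_fibre_in_inj
    quotient_fibre_in_range quotient_bundle_loc.

End QuotientBundle.

Section Configurations.
Variables (R : realType) (n : nat).
Local Notation C := (complexes R).

Definition config_set : set 'rV[C]_n := [set z : 'rV[C]_n | injective (z 0)].

Definition config_space : topologicalType := set_type config_set.

Lemma config_perm_subproof (z : config_space) (s : 'S_n) :
  col_perm s^-1%g (\val z) \in config_set.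
Proof.
apply/mem_set => i j; rewrite !mxE => /(set_mem (valP z)).
exact: perm_inj.
Qed.

(* (s z)_i = z_(s^-1 i); in the product of 'S_n the left factor acts first,
   so that this left action is written as a right action here. *)
Definition config_perm (z : config_space) (s : 'S_n) : config_space :=
  exist (fun x => x \in config_set) _ (config_perm_subproof z s).

Lemma config_perm1 : config_perm^~ 1%g =1 id.
Proof. by move=> z; apply: val_inj; rewrite /= invg1 col_perm1. Qed.

Lemma config_permM z : act_morph config_perm z.
Proof. by move=> s t; apply: val_inj; rewrite /= invMg col_permM. Qed.

Definition config_action : {action 'S_n &-> config_space} :=
  TotalAction config_perm1 config_permM.

Lemma config_action_free z s : config_action z s = z -> s = 1%g.
Proof.
move=> /(congr1 val) /= zs; apply/permP => i; rewrite perm1.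
have zi : (\val z) 0 (s^-1 (s i))%g = (\val z) 0 (s i).
  by have := congr1 (fun m : 'rV[C]_n => m 0 (s i)) zs; rewrite mxE.
by have := set_mem (valP z) _ _ zi; rewrite permK.
Qed.

Lemma config_coord_continuous i :
  continuous (fun z : config_space => (\val z) 0 i : C).
Proof.
move=> z; have c1 : {for z, continuous (set_val : config_set -> 'rV[C]_n)}.
  exact: initial_continuous.
exact: (continuous_comp c1 (@coord_continuous C _ _ 0 i _)).
Qed.

Lemma config_action_continuous s : continuous (config_action^~ s).
Proof.
move=> z; apply: initial_continuous_at; apply: mx_continuous_at => i j.
rewrite ord1 (_ : (fun t => _) = fun t : config_space => (\val t) 0 (s^-1%g j)).
  exact: config_coord_continuous.
by apply/funext => t; rewrite /= set_valE /= mxE.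
Qed.

Lemma config_space_hausdorff : hausdorff_space config_space.
Proof.
rewrite open_hausdorff => x y xy.
have [i xyi] : exists i, (\val x) 0 i != (\val y) 0 i.
  apply/existsP; apply: contraR xy => /existsPn xy.
  by apply/eqP/val_inj/rowP => i; apply/eqP; rewrite -[_ == _]negbK xy.
have := @norm_hausdorff C C; rewrite open_hausdorff.
move=> /(_ _ _ xyi)[[A B] [/= xA yB] [oA oB AB0]].
pose c (z : config_space) : C := (\val z) 0 i.
exists (c @^-1` A, c @^-1` B); first by split; rewrite inE; apply: set_mem.
have cc : continuous c := @config_coord_continuous i.
split; [exact: (open_comp (fun x _ => cc x)) | exact: (open_comp (fun x _ => cc x)) |].
by rewrite /= -preimage_setI (eqP AB0) preimage_set0.
Qed.

Definition KZ_bundle (U : vectType C) (rho : {action 'S_n &-> U})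
    (rho_linear : forall s, linear (rho^~ s)) :
    vector_bundle C (orbit_space config_action) :=
  quotient_bundle rho_linear config_action_continuous config_action_free
    config_space_hausdorff.

End Configurations.

(* Main.v *)
Require Import Defs.
From HB Require Import structures.
From mathcomp Require Import all_boot all_order all_algebra all_fingroup.
From mathcomp Require Import ring zify.
From mathcomp Require Import all_classical all_reals topology normedtype.

(** A trivialisation of the quotient of [X * U] by a finite group [G] is the
    same thing as a continuous family of automorphisms [g x] of [U] that
    intertwines [x] with its translates.  Such families exist for all
    representations at once as soon as one exists in the group algebra: it is
    enough to find a continuous scalar function [p] on [X] for which
    [sum_s p (x s) s] is an invertible element of [K[G]] at every point [x],
    and this invertibility is that of the matrix of the values of [p] at the
    translates of [x], the group determinant of [p]
    ([quotient_bundle_trivial]).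

    For configurations of [n] points such a [p] can be chosen polynomial
    ([group_determinant]).  Consider the [n!] staircase monomials of Artin
    [prod_i x_i ^ a_i] with [a_i <= i].  Modulo symmetric polynomials of
    positive degree every monomial is a combination of staircase monomials
    with constant coefficients, since [x_i ^ i.+1] reduces to monomials in
    [x_i, x_(i+1), ...] where it has smaller degree in [x_i] ([expX_lead]).
    Keeping track of the symmetric coefficients, the row [b] of
    staircase monomials satisfies [b (x s) = b x *m A s x], where the entries
    of [A s x] are symmetric functions of [x], are zero when the degree would
    have to go up, and are constant when it stays the same ([transition_mx]).
    When the coordinates of [x] are distinct, interpolation shows that
    polynomials separate the [n!] points of its orbit, so that the
    staircase monomials restrict to a basis of the functions on the orbit
    ([artin_mx_unit]) and the cocycle [A] is multiplicative.

    The blocks [D s] of [A s x] on the diagonal of the degree filtration are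
    constant in [x] and multiplicative: they give the action on coinvariants.
    Averaging [b] against [D] produces polynomials [h] with
    [h (x s) = h x *m D s], an equivariant lift of the coinvariants,
    and [h] differs from [b] by a matrix that is unitriangular for the
    degree up to the factor [n!], so [h] still restricts to a basis of the
    functions on every free orbit ([harmonic_frame]).  Finally, [p] is the
    combination of the [h] that restricts to a delta function on one chosen
    orbit.  The span of the [h] is a fixed copy of the regular
    representation in which the translates of [p] form a basis, and as it
    restricts isomorphically to every free orbit, the translates of [p] are a
    basis of the functions on each of them. *)

Set Implicit Arguments.
Unset Strict Implicit.
Unset Printing Implicit Defensive.

Import Order.TTheory GRing.Theory Num.Theory.
Import numFieldNormedType.Exports VectorInternalTheory.
Local Open Scope classical_set_scope.
Local Open Scope ring_scope.

(** * Combinations of monomials with prescribed coefficients *)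

Section Combinations.
Variables (F : comNzRingType) (n : nat).
Implicit Types (x : 'I_n -> F) (a d : {ffun 'I_n -> nat}) (s t : 'S_n).
Local Notation fn := (('I_n -> F) -> F).

Definition mon a : fn := fun x => \prod_i x i ^+ a i.
Definition deg a : nat := (\sum_i a i)%N.
Definition exp_add a d : {ffun 'I_n -> nat} := [ffun i => (a i + d i)%N].
Definition exp_single (i : 'I_n) (m : nat) : {ffun 'I_n -> nat} :=
  [ffun j => if j == i then m else 0%N].

Lemma monD a d x : mon (exp_add a d) x = mon a x * mon d x.
Proof. by rewrite -big_split; apply: eq_bigr => i _; rewrite ffunE exprD. Qed.

Lemma mon_single i m x : mon (exp_single i m) x = x i ^+ m.
Proof.
rewrite /mon (bigD1 i) //= ffunE eqxx big1 ?mulr1 // => j /negPf ji.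
by rewrite ffunE ji expr0.
Qed.

Lemma mon0 x : mon [ffun=> 0%N] x = 1.
Proof. by rewrite /mon big1 // => i _; rewrite ffunE expr0. Qed.

Lemma deg0 : deg [ffun=> 0%N] = 0%N.
Proof. by rewrite /deg big1 // => i _; rewrite ffunE. Qed.

Lemma degD a d : deg (exp_add a d) = (deg a + deg d)%N.
Proof. by rewrite -big_split; apply: eq_bigr => i _; rewrite ffunE. Qed.

Lemma deg_single i m : deg (exp_single i m) = m.
Proof.
rewrite /deg (bigD1 i) //= ffunE eqxx big1 ?addn0 // => j /negPf ji.
by rewrite ffunE ji.
Qed.

(** Coefficients are functions of the point, and [Q c a] tells which coefficients
    [c] may stand in front of the monomial of exponent [a].  Constants give
    polynomials, symmetric functions give the module they generate, and
    mixed conditions such as [lead] below describe congruences. *)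
Inductive combination (Q : fn -> {ffun 'I_n -> nat} -> Prop) : fn -> Prop :=
| combination0 : combination Q (fun=> 0)
| combination_add_term c a f : Q c a -> combination Q f ->
    combination Q (fun x => c x * mon a x + f x).

Section Closure.
Variable Q : fn -> {ffun 'I_n -> nat} -> Prop.

Lemma combination_eq f g : f =1 g -> combination Q f -> combination Q g.
Proof. by move=> /funext ->. Qed.

Lemma combinationD f g :
  combination Q f -> combination Q g -> combination Q (fun x => f x + g x).
Proof.
move=> sf sg; elim: sf => [|c a f' qca _ IH].
  by apply: combination_eq sg => x; rewrite add0r.
by apply: combination_eq (combination_add_term qca IH) => x; rewrite addrA.
Qed.

Lemma combination1 c a : Q c a -> combination Q (fun x => c x * mon a x).
Proof.
move=> q; apply: combination_eq (combination_add_term q (combination0 Q)) => x.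
by rewrite addr0.
Qed.

Lemma combination_sum (I : Type) (r : seq I) (f : I -> fn) :
  (forall i, combination Q (f i)) -> combination Q (fun x => \sum_(i <- r) f i x).
Proof.
move=> sf; elim: r => [|i r IH].
  by apply: combination_eq (combination0 Q) => x; rewrite big_nil.
by apply: combination_eq (combinationD (sf i) IH) => x; rewrite big_cons.
Qed.

End Closure.

Lemma combination_bind (Q Q' : fn -> {ffun 'I_n -> nat} -> Prop) (g f : fn) :
  (forall c a, Q c a -> combination Q' (fun x => g x * (c x * mon a x))) ->
  combination Q f -> combination Q' (fun x => g x * f x).
Proof.
move=> qq; elim=> [|c a f' qca _ IH].
  by apply: combination_eq (combination0 Q') => x; rewrite mulr0.
by apply: combination_eq (combinationD (qq _ _ qca) IH) => x; rewrite mulrDr.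
Qed.

Lemma combination_trans (Q Q' : fn -> {ffun 'I_n -> nat} -> Prop) (f : fn) :
  (forall c a, Q c a -> combination Q' (fun x => c x * mon a x)) ->
  combination Q f -> combination Q' f.
Proof.
move=> qq sf; have -> : f = (fun x => 1 * f x) by apply/funext => x; rewrite mul1r.
by apply: combination_bind sf => c a /qq; apply: combination_eq => x; rewrite mul1r.
Qed.

Lemma combination_sub (Q Q' : fn -> {ffun 'I_n -> nat} -> Prop) (f : fn) :
  (forall c a, Q c a -> Q' c a) -> combination Q f -> combination Q' f.
Proof. by move=> qq; apply: combination_trans => c a /qq /combination1. Qed.

Definition symmetric_fn (c : fn) := forall x s, c (x \o s) = c x.
Definition constant_fn (c : fn) := exists k, c = fun=> k.

Lemma constant_symmetric c : constant_fn c -> symmetric_fn c.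
Proof. by move=> [k ->]. Qed.

(** A combination of this kind is a homogeneous polynomial of degree [k] with
    exponents in [P], up to terms of degree below [k] whose coefficients are
    symmetric.  It is congruent to that polynomial modulo symmetric
    polynomials of positive degree, in a form that can be read on a single
    orbit, where symmetric coefficients are scalars. *)
Definition lead (P : {ffun 'I_n -> nat} -> Prop) (k : nat) (c : fn) a : Prop :=
  (symmetric_fn c /\ (deg a < k)%N) \/ [/\ constant_fn c, deg a = k & P a].

Lemma lead_mulX (P P' : {ffun 'I_n -> nat} -> Prop) k u d f : constant_fn u ->
  (forall a, P a -> P' (exp_add d a)) -> combination (lead P k) f ->
  combination (lead P' (deg d + k)) (fun x => u x * mon d x * f x).
Proof.
move=> [k0 ->] PP; apply: combination_bind => c a ca.
apply: (@combination_eq _ (fun x => (k0 * c x) * mon (exp_add d a) x)) => [x|].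
  by rewrite monD; ring.
apply: combination1; case: ca => [[sc da]|[[k1 ->] <- Pa]].
  left; split; last by rewrite degD ltn_add2l.
  by move=> x s; rewrite sc.
right; split; [by exists (k0 * k1)|exact: degD|exact: PP].
Qed.

Lemma leadZ (P : {ffun 'I_n -> nat} -> Prop) k k0 f :
  combination (lead P k) f -> combination (lead P k) (fun x => k0 * f x).
Proof.
have c0 : constant_fn (fun _ : 'I_n -> F => k0) by exists k0.
have add0 a : exp_add [ffun=> 0%N] a = a by apply/ffunP => j; rewrite !ffunE.
move=> /(lead_mulX (d := [ffun=> 0%N]) c0 (P' := P)); rewrite deg0 => lf.
apply: combination_eq (lf _) => [x|a]; first by rewrite mon0 mulr1.
by rewrite add0.
Qed.

End Combinations.

(** * Reduction to staircase monomials *)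

Section Reduction.
Variables (F : comNzRingType) (n : nat).
Implicit Types (x : 'I_n -> F) (a d : {ffun 'I_n -> nat}) (s t : 'S_n).
Local Notation fn := (('I_n -> F) -> F).

(** The [k]-th elementary symmetric polynomial of the first [i] variables. *)
Definition elsym (i k : nat) : fn :=
  fun x => (\prod_(j < n | (j < i)%N) (1 + (x j)%:P * 'X))`_k.

Lemma elsym_prodS (i : 'I_n) x :
  \prod_(j < n | (j < i.+1)%N) (1 + (x j)%:P * 'X) =
  (1 + (x i)%:P * 'X) * \prod_(j < n | (j < i)%N) (1 + (x j)%:P * 'X).
Proof.
rewrite (bigD1 i) ?ltnSn //=; congr (_ * _); apply: eq_bigl => j.
by rewrite ltnS andbC ltn_neqAle.
Qed.

Lemma elsym_0k k x : elsym 0 k x = (k == 0%N)%:R.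
Proof. by rewrite /elsym big_pred0 ?coef1. Qed.

Lemma elsym_S0 (i : 'I_n) x : elsym i.+1 0 x = elsym i 0 x.
Proof. by rewrite /elsym elsym_prodS mulrDl mul1r coefD -mulrA coefCM coefXM mulr0 addr0. Qed.

Lemma elsym_SS (i : 'I_n) k x : elsym i.+1 k.+1 x = elsym i k.+1 x + x i * elsym i k x.
Proof. by rewrite /elsym elsym_prodS mulrDl mul1r coefD -mulrA coefCM coefXM. Qed.

Lemma elsym_i0 i x : (i <= n)%N -> elsym i 0 x = 1.
Proof.
elim: i => [|i IH] lin; first exact: elsym_0k.
by rewrite (elsym_S0 (Ordinal lin)) IH // ltnW.
Qed.

Lemma elsym_gt i k x : (i <= n)%N -> (i < k)%N -> elsym i k x = 0.
Proof.
elim: i k => [|i IH] [|k] // lin lik; first by rewrite elsym_0k.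
by rewrite (elsym_SS (Ordinal lin)) !IH ?mulr0 ?addr0 // ltnW.
Qed.

Lemma elsym_symmetric k : symmetric_fn (elsym n k).
Proof.
move=> x s; rewrite /elsym; congr (nth 0 (polyseq _) k).
rewrite [RHS](reindex_inj (@perm_inj _ s)) /=.
by apply: eq_big => // j; rewrite !ltn_ord.
Qed.

Definition supp_ge (i : nat) a := forall j : 'I_n, (j < i)%N -> a j = 0%N.

(** Since [e_k (x_0 .. x_i) = e_k (x_0 .. x_(i-1)) + x_i e_(k-1) (x_0 .. x_(i-1))],
    the elementary polynomials of the first [i] variables are obtained from
    those of the first [i.+1] by dividing by [1 + x_i T].  The pure power
    of [x_i] that appears is kept apart, as it is the one that
    [expX_lead] solves for. *)
Lemma elsym_lead_step (i : 'I_n) m :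
  (forall k, combination (lead (supp_ge i.+1) k) (elsym i.+1 k)) ->
  combination (lead (fun a => supp_ge i a /\ (a i < m)%N) m)
    (fun x => elsym i m x - (- x i) ^+ m).
Proof.
move=> IH; elim: m => [|m IHm].
  by apply: combination_eq (combination0 _) => x; rewrite elsym_i0 ?expr0 ?subrr // ltnW.
apply: (@combination_eq _ _ _ (fun x => elsym i.+1 m.+1 x +
    - 1 * mon (exp_single i 1) x * (elsym i m x - (- x i) ^+ m))) => [x|].
  by rewrite elsym_SS mon_single [(- x i) ^+ _.+1]exprS expr1; move: (_ ^+ m) => y; ring.
apply: combinationD.
  apply: combination_sub (IH m.+1) => c a [[sc da]|[cc da Pa]]; [by left|right].
  by split=> //; split=> [j ji|]; rewrite Pa // (ltn_trans ji).
rewrite -[m.+1]add1n -[X in (X + m)%N](deg_single i 1%N).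
apply: (lead_mulX _ _ IHm); first by exists (-1).
move=> a [sa ai]; split=> [j ji|]; rewrite !ffunE.
  by rewrite sa // addn0; case: eqP ji => // ->; rewrite ltnn.
by rewrite eqxx deg_single.
Qed.

(** Going down from all the variables, where [e_k] is symmetric and hence of lower
    degree for positive [k], each division introduces one more of the last
    variables: up to lower terms, [e_k (x_0 .. x_(i-1))] is a polynomial in
    [x_i .. x_(n-1)] (it is a complete homogeneous polynomial up to sign). *)
Lemma elsym_lead i0 k : (i0 <= n)%N -> combination (lead (supp_ge i0) k) (elsym i0 k).
Proof.
move=> lin; rewrite -(subKn lin); move: (n - i0)%N (leq_subr i0 n) => {lin}m.
elim: m k => [|m IH] k lmn.
  rewrite subn0; apply: (@combination_eq _ _ _ (fun x => elsym n k x * mon [ffun=> 0%N] x)).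
    by move=> x; rewrite mon0 mulr1.
  apply: combination1; case: k => [|k].
    right; split; [exists 1|exact: deg0|by move=> j; rewrite ffunE].
    by apply/funext => x; rewrite elsym_i0.
  by left; split; [exact: elsym_symmetric|rewrite deg0].
have lt : (n - m.+1 < n)%N by lia.
pose i : 'I_n := Ordinal lt.
have Si : i.+1 = (n - m)%N by rewrite /=; lia.
have st := @elsym_lead_step i k.
rewrite Si in st; have {}st := st (fun k => IH k (ltnW lmn)).
apply: (@combination_eq _ _ _ (fun x =>
    (elsym i k x - (- x i) ^+ k) + (-1) ^+ k * mon (exp_single i k) x)).
  by move=> x; rewrite mon_single -exprNn subrK.
apply: combinationD; first by apply: combination_sub st => c a [?|[? ? []]]; [left|right].
apply: (@combination1 _ _ _ (fun=> (-1) ^+ k)); right.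
split; [by exists ((-1) ^+ k)|exact: deg_single|].
by move=> j ji; rewrite ffunE; case: eqP ji => // ->; rewrite ltnn.
Qed.

(** This is the vanishing of [e_(i+1)] on the [i] variables [x_0 .. x_(i-1)]. *)
Lemma expX_lead (i : 'I_n) :
  combination (lead (fun a => supp_ge i a /\ (a i < i.+1)%N) i.+1) (fun x => x i ^+ i.+1).
Proof.
have := leadZ ((-1) ^+ i) (@elsym_lead_step i i.+1 (fun k => @elsym_lead i.+1 k (ltn_ord i))).
apply: combination_eq => x.
have -> : elsym i i.+1 x = 0 by apply: elsym_gt => //; apply: ltnW.
rewrite sub0r [(- x i) ^+ _]exprNn exprS mulN1r mulNr opprK mulrA.
by rewrite -expr2 sqrr_sign mul1r.
Qed.

Definition artin a := forall i : 'I_n, (a i <= i)%N.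

(** Replacing [x_i ^ i.+1] by monomials in [x_i, x_(i+1), ...] moves exponents to
    later variables, which increases this weight at constant degree. *)
Definition weight a : nat := (\sum_(i < n) i * a i)%N.

Lemma weightD a d : weight (exp_add a d) = (weight a + weight d)%N.
Proof. by rewrite -big_split; apply: eq_bigr => i _; rewrite ffunE mulnDr. Qed.

Lemma weight_single i m : weight (exp_single i m) = (i * m)%N.
Proof.
rewrite /weight (bigD1 i) //= ffunE eqxx big1 ?addn0 // => j /negPf ji.
by rewrite ffunE ji muln0.
Qed.

Lemma weight_bound a : (weight a <= n * deg a)%N.
Proof.
rewrite /deg big_distrr /=; apply: leq_sum => i _.
by rewrite leq_mul2r ltnW ?orbT.
Qed.

Lemma weight_gt (i : 'I_n) a : supp_ge i a -> (a i < deg a)%N -> (i * deg a < weight a)%N.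
Proof.
move=> sa lt; rewrite /weight /deg big_distrr /=.
have [j ji aj] : exists2 j : 'I_n, j != i & (0 < a j)%N.
  apply/exists_inP; apply: contraTT lt => /exists_inPn H.
  rewrite -leqNgt /deg (bigD1 i) //= big1 ?addn0 // => j ji.
  by apply/eqP; rewrite -leqn0 leqNgt H.
have ij : (i < j)%N.
  rewrite ltn_neqAle [_ == _ :> nat]eq_sym ji leqNgt; apply: contraTN aj => /sa ->.
  by [].
rewrite (bigD1 j) //= [X in (_ < X)%N](bigD1 j) //= -addSn leq_add ?ltn_pmul2r //.
apply: leq_sum => k _; case: (ltnP k i) => [/sa ->|ik]; first by rewrite !muln0.
by rewrite leq_mul2r ik orbT.
Qed.

(** A factor [x_i ^ i.+1] can be traded for terms of larger weight or of lower
    degree, and this terminates because the weight is bounded in terms of the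
    degree. *)
Lemma mon_lead a : combination (lead artin (deg a)) (@mon F n a).
Proof.
move eqm: (n * deg a - weight a)%N => m; elim/ltn_ind: m a eqm => m IH a eqm.
case: (pselect (artin a)) => [aa|na].
  apply: (@combination_eq _ _ _ (fun x => 1 * mon a x)) => [x|]; first by rewrite mul1r.
  by apply: (@combination1 _ _ _ (fun=> 1)); right; split=> //; exists 1.
have [i ai] : exists i : 'I_n, (i < a i)%N.
  apply: contrapT => H; apply: na => i; rewrite leqNgt; apply/negP => ?.
  by apply: H; exists i.
pose d : {ffun 'I_n -> nat} := [ffun j => if j == i then (a i - i.+1)%N else a j].
have ad : a = exp_add d (exp_single i i.+1).
  apply/ffunP => j; rewrite !ffunE; case: eqP => [->|_]; last by rewrite addn0.
  by rewrite subnK.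
have da : deg a = (deg d + i.+1)%N by rewrite ad degD deg_single.
have Xi : combination (lead (fun b => supp_ge i b /\ (b i < deg b)%N /\ deg b = i.+1)
    i.+1) (fun x => x i ^+ i.+1).
  apply: combination_sub (expX_lead i) => c b [low|[cc db [sb bi]]]; [by left|right].
  by split; rewrite ?db.
have c1 : constant_fn (fun _ : 'I_n -> F => 1 : F) by exists 1.
have := lead_mulX (d := d) c1 (P' := fun b => (weight a < weight b)%N) _ Xi.
rewrite -da => aX.
apply: (@combination_eq _ _ _ (fun x => 1 * mon d x * x i ^+ i.+1)) => [x|].
  by rewrite mul1r [in RHS]ad monD mon_single.
apply: (combination_trans _ (aX _)) => [c b [low|[[k ->] db wb]]|b [sb [bi db]]].
- by apply: combination1; left.
- apply: leadZ; have := IH _ _ b erefl; rewrite db; apply.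
  by have := weight_bound b; rewrite db; lia.
by rewrite ad !weightD ltn_add2l weight_single -db weight_gt.
Qed.

(** The refinement of [lead artin k] in which the lower terms are also staircase
    monomials, so that the combination is an expansion in the staircase
    monomials with symmetric coefficients. *)
Definition artin_lead (k : nat) (c : fn) a : Prop :=
  [/\ symmetric_fn c, (deg a <= k)%N, deg a = k -> constant_fn c & artin a].

Lemma mon_artin_lead a : combination (artin_lead (deg a)) (@mon F n a).
Proof.
move eqk: (deg a) => k; elim/ltn_ind: k a eqk => k IH a eqk.
have := mon_lead a; rewrite eqk; apply: combination_trans => c b [[sc db]|[cc db ab]].
  apply: combination_bind (IH _ db b erefl) => e a' [se da' _ aa'].
  apply: (@combination_eq _ _ _ (fun x => (c x * e x) * mon a' x)) => [x|]; first by rewrite mulrA.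
  apply: combination1; split=> //.
  - by move=> x s; rewrite sc se.
  - exact: leq_trans da' (ltnW db).
  - by move=> e'; move: da'; rewrite e' leqNgt db.
by apply: combination1; split=> //; [exact: constant_symmetric|rewrite db].
Qed.

End Reduction.

(** * Matrices that are triangular for a degree *)

Section GradedMatrices.
Variables (F : fieldType) (N : nat) (g : 'I_N -> nat).
Implicit Types M : 'M[F]_N.

Definition graded_tri M := forall i j, (g j < g i)%N -> M i j = 0.

(** The induced action on the associated graded space, written as a matrix of the
    same size. *)
Definition diag_blocks M : 'M[F]_N :=
  \matrix_(i, j) if g i == g j then M i j else 0.

Lemma diag_blocks_tri M : graded_tri (diag_blocks M).
Proof. by move=> i j ji; rewrite mxE gtn_eqF. Qed.

Lemma diag_blocks_id M : diag_blocks (diag_blocks M) = diag_blocks M.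
Proof. by apply/matrixP => i j; rewrite !mxE; case: eqP. Qed.

Lemma graded_triM M M' : graded_tri M -> graded_tri M' -> graded_tri (M *m M').
Proof.
move=> tM tM' i j ji; rewrite mxE big1 // => k _.
case: (ltnP (g k) (g i)) => [/tM ->|ik]; first by rewrite mul0r.
by rewrite tM' ?mulr0 // (leq_trans ji).
Qed.

Lemma diag_blocksM M M' : graded_tri M -> graded_tri M' ->
  diag_blocks (M *m M') = diag_blocks M *m diag_blocks M'.
Proof.
move=> tM tM'; apply/matrixP => i j; rewrite !mxE; case: eqP => [ij|ij].
  apply: eq_bigr => k _; rewrite !mxE ij; case: (ltngtP (g k) (g j)) => // kj.
    by rewrite tM ?mul0r // ij.
  by rewrite tM' ?mulr0.
apply/esym/big1 => k _; rewrite !mxE; case: eqP => [ik|_]; last by rewrite mul0r.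
by rewrite -ik; case: eqP => // _; rewrite mulr0.
Qed.

Lemma diag_blocks_sum (I : Type) (r : seq I) (f : I -> 'M[F]_N) :
  diag_blocks (\sum_(i <- r) f i) = \sum_(i <- r) diag_blocks (f i).
Proof.
apply/matrixP => i j; rewrite mxE !summxE; case: ifP => ij.
  by apply: eq_bigr => k _; rewrite mxE ij.
by rewrite big1 // => k _; rewrite mxE ij.
Qed.

Lemma graded_tri_sum (I : Type) (r : seq I) (f : I -> 'M[F]_N) :
  (forall i, graded_tri (f i)) -> graded_tri (\sum_(i <- r) f i).
Proof. by move=> tf i j ij; rewrite summxE big1 // => k _; exact: tf. Qed.

Lemma graded_tri_unit M c :
  graded_tri M -> diag_blocks M = c%:M -> c != 0 -> M \in unitmx.
Proof.
move=> tM dM c0; rewrite -row_free_unit -kermx_eq0; apply/eqP/row_matrixP => i0.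
rewrite row0; set v := row i0 _.
have vM : v *m M = 0 by rewrite -row_mul mulmx_ker row0.
have Mij i j : g i = g j -> M i j = c *+ (i == j).
  by move=> ij; have := congr1 (fun X : 'M_N => X i j) dM; rewrite /= !mxE ij eqxx.
suff H m j : g j = m -> v 0 j = 0 by apply/rowP => j; rewrite (H _ _ erefl) mxE.
elim/ltn_ind: m j => m IH j gj.
have := congr1 (fun X : 'rV_N => X 0 j) vM; rewrite /= [LHS]mxE [RHS]mxE (bigD1 j) //=.
rewrite big1 ?addr0 => [|k kj].
  by rewrite Mij // eqxx mulr1n => /eqP; rewrite mulf_eq0 (negPf c0) orbF => /eqP.
case: (ltngtP (g k) (g j)) => gk; last by rewrite Mij // (negPf kj) mulr0.
  by rewrite (IH _ _ _ erefl) ?mul0r // -gj.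
by rewrite tM ?mulr0.
Qed.

End GradedMatrices.

(** * Staircase monomials on a free orbit *)

Section Artin.
Variables (F : fieldType) (n : nat).
Implicit Types (x : 'I_n -> F) (a d : {ffun 'I_n -> nat}) (s t : 'S_n).
Local Notation fn := (('I_n -> F) -> F).
Local Notation N := #|{perm 'I_n}|.

(** There are [\prod_i i.+1] staircase exponents, which is the order of the group;
    this count is what makes [artin_mx] below a square matrix. *)
Lemma artin_enum :
  exists e : 'I_N -> {ffun 'I_n -> nat}, forall a, artin a -> exists j, e j = a.
Proof.
pose D := {dffun forall i : 'I_n, 'I_i.+1}.
have cD : N = #|{: D}|.
  have /= -> := card_dep_ffun (fun i : 'I_n => 'I_i.+1).
  rewrite card_Sn foldrE big_map big_enum /=.
  by rewrite fact_prod big_add1 /= big_mkord; apply: eq_bigr => i _; rewrite card_ord.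
exists (fun j => [ffun i => val ((enum_val (cast_ord cD j) : D) i)]) => a aa.
pose b : D := [ffun i : 'I_n => Ordinal (aa i : (a i < i.+1)%N)].
exists (cast_ord (esym cD) (enum_rank b)).
by apply/ffunP => i; rewrite ffunE cast_ordKV enum_rankK ffunE.
Qed.

Definition poly_fn : fn -> Prop := combination (fun c _ => constant_fn c).

Lemma poly_fnM (f f' : fn) : poly_fn f -> poly_fn f' -> poly_fn (fun x => f x * f' x).
Proof.
move=> pf pf'; apply: combination_bind pf' => c' a' [k' ->].
apply: (@combination_eq _ _ _ (fun x => k' * mon a' x * f x)) => [x|]; first by rewrite mulrC.
apply: combination_bind pf => c a [k ->].
apply: (@combination_eq _ _ _ (fun x => (k' * k) * mon (exp_add a' a) x)) => [x|].
  by rewrite monD; ring.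
by apply: (@combination1 _ _ _ (fun=> _)); exists (k' * k).
Qed.

Lemma poly_fn_const k : poly_fn (fun=> k).
Proof.
apply: (@combination_eq _ _ _ (fun x => k * mon [ffun=> 0%N] x)) => [x|].
  by rewrite mon0 mulr1.
by apply: (@combination1 _ _ _ (fun=> k)); exists k.
Qed.

Lemma poly_fn_X i : poly_fn (fun x => x i).
Proof.
apply: (@combination_eq _ _ _ (fun x => 1 * mon (exp_single i 1) x)) => [x|].
  by rewrite mon_single mul1r.
by apply: (@combination1 _ _ _ (fun=> 1)); exists 1.
Qed.

Lemma poly_fn_prod (I : Type) (r : seq I) (P : pred I) (f : I -> fn) :
  (forall i, poly_fn (f i)) -> poly_fn (fun x => \prod_(i <- r | P i) f i x).
Proof.
move=> pf; elim: r => [|i r IH].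
  by apply: combination_eq (poly_fn_const 1) => x; rewrite big_nil.
case Pi: (P i); last by apply: combination_eq IH => x; rewrite big_cons Pi.
by apply: combination_eq (poly_fnM (pf i) IH) => x; rewrite big_cons Pi.
Qed.

Definition exp_perm a s : {ffun 'I_n -> nat} := [ffun i => a (s^-1 i)%g].

Lemma mon_perm a s x : mon a (x \o s) = mon (exp_perm a s) x.
Proof.
rewrite /mon [RHS](reindex_inj (@perm_inj _ s)) /=.
by apply: eq_bigr => i _; rewrite ffunE permK.
Qed.

Lemma deg_perm a s : deg (exp_perm a s) = deg a.
Proof.
rewrite /deg (reindex_inj (@perm_inj _ s)) /=.
by apply: eq_bigr => i _; rewrite ffunE permK.
Qed.

Lemma poly_fn_mon_perm a s : poly_fn (fun x => mon a (x \o s)).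
Proof.
apply: (@combination_eq _ _ _ (fun x => 1 * mon (exp_perm a s) x)) => [x|].
  by rewrite mon_perm mul1r.
by apply: (@combination1 _ _ _ (fun=> 1)); exists 1.
Qed.

(** The factors vanish at [x \o t] as soon as [t i = s j] for some [j != i]. *)
Lemma interpolation x s : injective x ->
  exists2 f, poly_fn f & forall t, f (x \o t) = (t == s)%:R.
Proof.
move=> xi.
exists (fun w => \prod_i \prod_(j | j != i) ((w i - x (s j)) * (x (s i) - x (s j))^-1)).
  apply: poly_fn_prod => i; apply: poly_fn_prod => j; apply: poly_fnM.
    by apply: combinationD; [exact: poly_fn_X|exact: poly_fn_const].
  exact: poly_fn_const.
move=> t; case: eqP => [->|/eqP ts].
  rewrite big1 // => i _; rewrite big1 // => j ji.
  by rewrite divff // subr_eq0; apply: contra ji => /eqP/xi/perm_inj ->.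
have [i ti] : exists i, t i != s i.
  by apply/existsP; apply: contraNT ts => /existsPn H; apply/eqP/permP => i;
     apply/eqP; rewrite -[_ == _]negbK H.
rewrite (bigD1 i) //= (bigD1 ((s^-1)%g (t i))) //=.
  by rewrite permKV subrr mul0r mul0r mul0r.
by apply: contra ti => /eqP {2}<-; rewrite permKV.
Qed.

Variable e : 'I_N -> {ffun 'I_n -> nat}.
Hypothesis eP : forall a, artin a -> exists j, e j = a.

(** Collecting the terms of a combination of staircase monomials: a property [P j]
    that is stable under the addition of allowed coefficients passes to the
    coefficient of the [j]-th monomial. *)
Lemma combination_coeff (Q : fn -> {ffun 'I_n -> nat} -> Prop) (P : 'I_N -> fn -> Prop) f :
  (forall j, P j (fun=> 0)) ->
  (forall j c c', Q c (e j) -> P j c' -> P j (fun x => c x + c' x)) ->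
  (forall c a, Q c a -> artin a) -> combination Q f ->
  exists2 c : 'I_N -> fn, (forall j, P j (c j)) &
    forall x, f x = \sum_j mon (e j) x * c j x.
Proof.
move=> P0 PD Qa; elim=> [|c a f' qca _ [c' Pc' fE]].
  by exists (fun _ _ => 0) => // x; rewrite big1 // => j _; rewrite mulr0.
have [k ek] := eP (Qa _ _ qca).
exists (fun j x => (if j == k then c x else 0) + c' j x) => [j|x].
  case: eqP => [->|_]; first by apply: PD => //; rewrite ek.
  have -> : (fun x => 0 + c' j x) = c' j by apply/funext => x; rewrite add0r.
  exact: Pc'.
rewrite (eq_bigr _ (fun j _ => mulrDr _ _ _)) big_split /= -fE.
rewrite (bigD1 k) //= eqxx ek big1 ?addr0 1?mulrC // => j /negPf ->.
by rewrite mulr0.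
Qed.

(** The three conditions say that the reduction does not raise the degree and is
    constant in top degree. *)
Lemma mon_coeff a : exists2 c : 'I_N -> fn,
  (forall j, [/\ symmetric_fn (c j),
    (deg a < deg (e j))%N -> c j = fun=> 0 &
    deg (e j) = deg a -> constant_fn (c j)]) &
  forall x, mon a x = \sum_j mon (e j) x * c j x.
Proof.
apply: (@combination_coeff (artin_lead (deg a)) (fun j c => [/\ symmetric_fn c,
    (deg a < deg (e j))%N -> c = fun=> 0 & deg (e j) = deg a -> constant_fn c]));
  last exact: mon_artin_lead.
- by move=> j; split=> // _; exists 0.
- move=> j c c' [sc dj cc _] [sc' d0 cc'].
  split=> [x s|lt|E]; first by rewrite sc sc'.
    by move: dj; rewrite leqNgt lt.
  by have [k ->] := cc E; have [k' ->] := cc' E; exists (k + k').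
- by move=> c b [].
Qed.

Lemma poly_fn_coeff f : poly_fn f ->
  exists2 c : 'I_N -> fn, (forall j, symmetric_fn (c j)) &
    forall x, f x = \sum_j mon (e j) x * c j x.
Proof.
move=> pf; apply: (@combination_coeff (fun c a => symmetric_fn c /\ artin a)
  (fun=> @symmetric_fn F n)) => //.
- by move=> _ c c' [sc _] sc' x s; rewrite sc sc'.
- by move=> c a [].
apply: combination_trans pf => c a [k ->].
apply: combination_bind (mon_artin_lead F a) => c' a' [sc _ _ aa].
apply: (@combination_eq _ _ _ (fun x => (k * c' x) * mon a' x)) => [x|].
  by rewrite mulrA.
by apply: combination1; split=> // x s; rewrite sc.
Qed.

Definition artin_row x : 'rV[F]_N := \row_j mon (e j) x.
Definition artin_mx x : 'M[F]_N := \matrix_(r, j) mon (e j) (x \o (enum_val r : 'S_n)).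

(** Delta functions on the orbit are polynomials, polynomials expand in staircase
    monomials with symmetric coefficients, and those are scalars on the orbit:
    the staircase monomials span all functions on the orbit, and there are
    just enough of them to be a basis. *)
Lemma artin_mx_unit x : injective x -> artin_mx x \in unitmx.
Proof.
move=> xi.
suff /choice[C CP] : forall k : 'I_N, exists c : 'cV[F]_N,
    artin_mx x *m c = \col_r (r == k)%:R.
  suff BC : artin_mx x *m (\matrix_(i, k) C k i 0) = 1%:M.
    by case: (mulmx1_unit BC).
  apply/matrixP => r k; have := congr1 (fun M : 'cV_N => M r 0) (CP k).
  by rewrite !mxE => <-; apply: eq_bigr => i _; rewrite !mxE.
move=> k; have [f pf fE] := interpolation (enum_val k : 'S_n) xi.
have [c sc cE] := poly_fn_coeff pf.
exists (\col_j c j x); apply/colP => r; rewrite !mxE.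
rewrite -[RHS](_ : ((enum_val r : 'S_n) == enum_val k)%:R = _); last first.
  by congr (_ %:R); rewrite (inj_eq enum_val_inj).
by rewrite -fE cE; apply: eq_bigr => j _; rewrite !mxE sc.
Qed.

End Artin.

(** * A polynomial with invertible group determinant *)

Section GroupDeterminant.
Variables (F : numFieldType) (n : nat).
Implicit Types (x : 'I_n -> F) (a d : {ffun 'I_n -> nat}) (s t : 'S_n).
Local Notation fn := (('I_n -> F) -> F).
Local Notation N := #|{perm 'I_n}|.
Variable e : 'I_N -> {ffun 'I_n -> nat}.
Hypothesis eP : forall a, artin a -> exists j, e j = a.
Local Notation bv := (artin_row e).
Local Notation blocks := (diag_blocks (fun j => deg (e j))).
Local Notation tri := (graded_tri (fun j => deg (e j))).

Lemma natr_ord_inj : injective (fun i : 'I_n => i%:R : F).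
Proof. by move=> i j /eqP; rewrite eqr_nat => /eqP/val_inj. Qed.

Lemma comp_permM x s t : (x \o s) \o t = x \o (t * s)%g.
Proof. by apply/funext => i; rewrite /= permM. Qed.

Lemma transition_mx : exists A : 'S_n -> ('I_n -> F) -> 'M[F]_N,
  [/\ forall s x, bv (x \o s) = bv x *m A s x,
      forall s x t, A s (x \o t) = A s x,
      forall s x, tri (A s x) &
      forall s x y, blocks (A s x) = blocks (A s y)].
Proof.
have /choice[c cP] : forall st : 'S_n * 'I_N, exists c : 'I_N -> fn,
    (forall j, [/\ symmetric_fn (c j),
      (deg (e st.2) < deg (e j))%N -> c j = fun=> 0 &
      deg (e j) = deg (e st.2) -> constant_fn (c j)]) /\
    forall x, mon (e st.2) (x \o st.1) = \sum_j mon (e j) x * c j x.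
  move=> [s j] /=; have [c c1 c2] := @mon_coeff F n e eP (exp_perm (e j) s).
  rewrite deg_perm in c1; exists c; split=> // x.
  by rewrite mon_perm c2.
exists (fun s x => \matrix_(i, j) c (s, j) i x); split.
- move=> s x; apply/rowP => j; rewrite !mxE; have [_ /= ->] := cP (s, j).
  by apply: eq_bigr => i _; rewrite !mxE.
- move=> s x t; apply/matrixP => i j; rewrite !mxE.
  by have [/(_ i)[-> _ _] _] := cP (s, j).
- move=> s x i j ji; rewrite mxE.
  by have [/(_ i)[_ /(_ ji) -> _] _] := cP (s, j).
move=> s x y; apply/matrixP => i j; rewrite !mxE; case: eqP => // ij.
by have [/(_ i)[_ _ /(_ ij)[k ->]] _] := cP (s, j).
Qed.

Lemma row_artin_mx x r : row r (artin_mx e x) = bv (x \o (enum_val r : 'S_n)).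
Proof. by apply/rowP => j; rewrite !mxE. Qed.

(** [h] lifts the coinvariants equivariantly to polynomials, as harmonic polynomials
    do.  It is the Maschke average of the staircase monomials with respect to the
    action [D] on coinvariants. *)
Lemma harmonic_frame : exists (h : ('I_n -> F) -> 'rV[F]_N) (D : 'S_n -> 'M[F]_N),
  [/\ forall j, poly_fn (fun x => h x 0 j),
      forall x s, h (x \o s) = h x *m D s &
      forall x, injective x ->
        (\matrix_(r, j) h (x \o (enum_val r : 'S_n)) 0 j) \in unitmx].
Proof.
have [A [bA symA triA cstA]] := transition_mx.
pose x0 (i : 'I_n) : F := i%:R.
have x0_inj : injective x0 := @natr_ord_inj.
pose D s := blocks (A s x0).
(* On a free orbit a row of coefficients is determined by the function it defines. *)
have artinK x (M M' : 'M[F]_N) : injective x ->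
    (forall r : 'I_N, bv (x \o (enum_val r : 'S_n)) *m M =
       bv (x \o (enum_val r : 'S_n)) *m M') ->
    M = M'.
  move=> xi MM; apply: (can_inj (mulKmx (artin_mx_unit eP xi))).
  by apply/row_matrixP => r; rewrite !row_mul row_artin_mx.
(* The cocycle [A] is a homomorphism because its values are symmetric functions. *)
have AM s t : A (t * s)%g x0 = A s x0 *m A t x0.
  apply: (artinK x0 _ _ x0_inj) => r; set y := x0 \o _.
  have Ay u : A u x0 = A u y by rewrite symA.
  by rewrite !Ay mulmxA -(bA _ y) -(bA _ y) -comp_permM (bA t (y \o s)) symA.
have A1 : A 1%g x0 = 1%:M.
  apply: (artinK x0 _ _ x0_inj) => r; set y := x0 \o _.
  rewrite -[A _ x0](symA _ _ (enum_val r)) -bA mulmx1; congr bv.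
  by apply/funext => i; rewrite /= perm1.
have DM s t : D (t * s)%g = D s *m D t by rewrite /D AM diag_blocksM.
have D1 : D 1%g = 1%:M.
  apply/matrixP => i j; rewrite /D A1 !mxE; case: (i =P j) => [->|_]; first by rewrite eqxx.
  by rewrite if_same.
pose h x := \sum_(s : 'S_n) bv (x \o s) *m D (s^-1)%g.
pose T x := \sum_(s : 'S_n) A s x *m D (s^-1)%g.
have hT x : h x = bv x *m T x.
  by rewrite mulmx_sumr; apply: eq_bigr => s _; rewrite bA mulmxA.
have symT x s : T (x \o s) = T x.
  by apply: eq_bigr => t _; rewrite symA.
have T_unit x : T x \in unitmx.
  have trT s : tri (A s x *m D s^-1%g).
    by apply: graded_triM => //; exact: diag_blocks_tri.
  (* Each of the [n!] summands of [T] has the identity [D s *m D s^-1] as its blocks. *)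
  apply: (@graded_tri_unit _ _ _ _ (#|{perm 'I_n}|%:R)).
  - exact: graded_tri_sum.
  - rewrite diag_blocks_sum (eq_bigr (fun=> 1%:M)) => [|s _].
      by rewrite sumr_const -(raddfMn (@scalar_mx F _)).
    rewrite diag_blocksM //; last exact: diag_blocks_tri.
    by rewrite diag_blocks_id (cstA _ _ x0) -/(D s) -DM mulVg D1.
  by rewrite pnatr_eq0 -lt0n; apply/card_gt0P; exists 1%g.
exists h, D; split.
- move=> j.
  apply: (@combination_eq _ _ _ (fun x =>
      \sum_(s : 'S_n) \sum_i mon (e i) (x \o s) * D s^-1%g i j)).
    move=> x; rewrite summxE; apply: eq_bigr => s _; rewrite mxE.
    by apply: eq_bigr => i _; rewrite [bv _ _ _]mxE.
  apply: combination_sum => s; apply: combination_sum => i; apply: poly_fnM.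
    exact: poly_fn_mon_perm.
  exact: poly_fn_const.
- move=> x t; rewrite /h (reindex_inj (mulIg t^-1)%g) /= mulmx_suml.
  apply: eq_bigr => s _; rewrite comp_permM mulgKV -mulmxA -DM.
  by rewrite invMg invgK.
move=> x xi.
have -> : \matrix_(r, j) h (x \o (enum_val r : 'S_n)) 0 j = artin_mx e x *m T x.
  apply/row_matrixP => r; rewrite row_mul row_artin_mx -(symT _ (enum_val r : 'S_n)) -hT.
  by apply/rowP => j; rewrite !mxE.
by rewrite unitmx_mul T_unit artin_mx_unit.
Qed.

End GroupDeterminant.

Section Translates.
Variables (F : numFieldType) (n : nat).
Local Notation N := #|{perm 'I_n}|.

(** [p] is the function in the span of [h] equal to the delta function at [x0] on the
    orbit of [x0].  The matrix factors as [H x *m X], where [H x] holds the values of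
    [h] on the orbit of [x] and [X] the coordinates of the translates of [p]; the
    factor [X] does not depend on [x], and at [x0] the product is a permutation
    matrix. *)
Lemma group_determinant :
  exists2 p : ('I_n -> F) -> F, poly_fn p &
    forall x, injective x ->
      \matrix_(r < N, k < N) p ((x \o (enum_val r : 'S_n)) \o (enum_val k : 'S_n))
        \in unitmx.
Proof.
have [e eP] := artin_enum n.
have [h [D [ph hD hU]]] := @harmonic_frame F n e eP.
pose H x := \matrix_(r < N, j < N) h (x \o (enum_val r : 'S_n)) 0 j.
pose x0 (i : 'I_n) : F := i%:R.
have x0_inj : injective x0 := @natr_ord_inj F n.
pose v : 'cV[F]_N :=
  invmx (H x0) *m \col_(r < N) ((enum_val r : 'S_n) == 1%g)%:R.
pose p x : F := (h x *m v) 0 0.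
have p0 (s : 'S_n) : p (x0 \o s) = (s == 1%g)%:R.
  have Hv : H x0 *m v = \col_(r < N) ((enum_val r : 'S_n) == 1%g)%:R.
    by rewrite mulKVmx //; exact: hU.
  have := congr1 (fun M : 'cV_N => M (enum_rank s) 0) Hv.
  rewrite /= [RHS]mxE enum_rankK => <-; rewrite /p !mxE.
  by apply: eq_bigr => j _; rewrite [H x0 _ _]mxE enum_rankK.
pose X := \matrix_(i < N, k < N) (D (enum_val k : 'S_n) *m v) i 0.
pose M x := \matrix_(r < N, k < N)
  p ((x \o (enum_val r : 'S_n)) \o (enum_val k : 'S_n)).
have MHX x : M x = H x *m X.
  apply/matrixP => r k; rewrite !mxE /p hD -mulmxA mxE.
  by apply: eq_bigr => j _; rewrite !mxE.
have M0 r k : M x0 r k = (((enum_val k : 'S_n) * enum_val r)%g == 1%g)%:R.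
  by rewrite mxE comp_permM p0.
exists p.
  apply: (@combination_eq _ _ _ (fun x => \sum_j h x 0 j * v j 0)) => [x|].
    by rewrite /p mxE.
  by apply: combination_sum => j; apply: poly_fnM; [exact: ph|exact: poly_fn_const].
move=> x xi; rewrite -/(M x) MHX unitmx_mul hU //=.
(* [M x0] is the permutation matrix of the inversion of the group. *)
have : M x0 *m M x0 = 1%:M.
  apply/matrixP => r k; rewrite !mxE (bigD1 (enum_rank (enum_val r : 'S_n)^-1%g)) //=.
  rewrite !M0 enum_rankK mulVg eqxx mul1r big1 ?addr0 => [|j jr].
    by rewrite -eq_mulgV1 (inj_eq enum_val_inj) eq_sym.
  rewrite M0 -eq_invg_mul; case: eqP => [E|_]; last by rewrite mul0r.
  by case/eqP: jr; rewrite -E invgK enum_valK.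
by case/mulmx1_unit; rewrite MHX unitmx_mul => /andP[].
Qed.

End Translates.

(** * Continuity of determinants and inverse matrices *)

Section Continuity.
Variables (K : numFieldType) (T : topologicalType).

Lemma prod_continuous_at (I : Type) (r : seq I) (f : I -> T -> K) (x : T) :
  (forall i, {for x, continuous (f i)}) ->
  {for x, continuous (fun t => \prod_(i <- r) f i t)}.
Proof.
move=> cf; elim: r => [|i r IHr].
  have -> : (fun t => \prod_(i <- [::]) f i t) = cst 1.
    by apply/funext => t; rewrite big_nil.
  exact: cvg_cst.
have -> : (fun t => \prod_(j <- i :: r) f j t)
    = f i \* (fun t => \prod_(j <- r) f j t).
  by apply/funext => t; rewrite big_cons.
by apply: continuousM; [exact: cf | exact: IHr].
Qed.

Lemma det_continuous_at m (A : T -> 'M[K]_m) (x : T) :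
  (forall i j, {for x, continuous (fun t => A t i j)}) ->
  {for x, continuous (fun t => \det (A t))}.
Proof.
move=> cA; apply: sum_continuous_at => s; apply: continuousM.
  exact: cst_continuous.
by apply: prod_continuous_at => i; exact: cA.
Qed.

Lemma invmx_continuous_at m (A : T -> 'M[K]_m) (x : T) i j :
  (forall t, A t \in unitmx) ->
  (forall i j, {for x, continuous (fun t => A t i j)}) ->
  {for x, continuous (fun t => invmx (A t) i j)}.
Proof.
move=> uA cA.
have -> : (fun t => invmx (A t) i j) =
    (fun t => (\det (A t))^-1 * ((-1) ^+ (j + i) * \det (row' j (col' i (A t))))).
  by apply/funext => t; rewrite /invmx uA !mxE.
apply: continuousM.
  apply: continuousV; last exact: det_continuous_at.
  by rewrite -unitfE -unitmxE.
apply: continuousM; first exact: cst_continuous.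
apply: det_continuous_at => k l.
rewrite (_ : (fun t => _) = fun t => A t (lift j k) (lift i l)) //.
by apply/funext => t; rewrite !mxE.
Qed.

End Continuity.

(** * The action of the group algebra *)

Section GroupAlgebraAction.
Variables (K : numFieldType) (aT : finGroupType) (U : vectType K).
Variable (toU : {action aT &-> U}).
Hypothesis toU_linear : forall s, linear (toU^~ s).

(** The action of [sum_s c s s] in the group algebra. *)
Definition galg_act (c : aT -> K) (u : U) : U := \sum_s c s *: toU u s.

Lemma toU_sum (I : Type) (r : seq I) (k : I -> K) (f : I -> U) s :
  toU (\sum_(i <- r) k i *: f i) s = \sum_(i <- r) k i *: toU (f i) s.
Proof.
pose L : {linear U -> U} :=
  HB.pack (toU^~ s) (GRing.isLinear.Build _ _ _ _ _ (toU_linear s)).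
rewrite [LHS](linear_sum L); apply: eq_bigr => i _; exact: (linearZZ L).
Qed.

Lemma galg_act_linear c : linear (galg_act c).
Proof.
move=> k u v; rewrite /galg_act scaler_sumr -big_split; apply: eq_bigr => s _.
by rewrite toU_linear scalerDr !scalerA mulrC.
Qed.

Lemma galg_actM c d u :
  galg_act c (galg_act d u) = galg_act (fun r => \sum_t d t * c (t^-1 * r)%g) u.
Proof.
rewrite /galg_act (eq_bigr (fun s => \sum_t (d t * c s) *: toU u (t * s)%g)).
  rewrite exchange_big /= (eq_bigr (fun t => \sum_r (d t * c (t^-1 * r)%g) *: toU u r)).
    by rewrite exchange_big; apply: eq_bigr => r _; rewrite scaler_suml.
  move=> t _; rewrite (reindex_inj (mulgI t^-1%g)) /=.
  by apply: eq_bigr => r _; rewrite mulKVg.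
move=> s _; rewrite toU_sum scaler_sumr; apply: eq_bigr => t _.
by rewrite scalerA mulrC total_actM.
Qed.

Lemma galg_act1 c u : (forall s, c s = (s == 1%g)%:R) -> galg_act c u = u.
Proof.
move=> cE; rewrite /galg_act (bigD1 1%g) //= cE eqxx scale1r total_act1.
by rewrite big1 ?addr0 // => s /negPf s1; rewrite cE s1 scale0r.
Qed.

Lemma galg_act_continuous_at (X : topologicalType) (c : X -> aT -> K) (x : X) (u : U) :
  (forall s, {for x, continuous (fun y => c y s)}) ->
  {for (x, u), continuous (fun p : X * vtop U => galg_act (c p.1) p.2 : vtop U)}.
Proof.
move=> cc.
pose G (p : X * vtop U) : initial_topology (v2r : U -> 'rV[K]_(dim U)) :=
  galg_act (c p.1) p.2.
suff H : {for (x, u), continuous G} by exact: H.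
refine (@initial_continuous_at U _ _ (v2r : U -> 'rV[K]_(dim U)) G (x,u) _).
apply: mx_continuous_at => i j.
rewrite (_ : (fun t => _) = fun p : X * vtop U =>
    \sum_s c p.1 s * v2r (toU p.2 s) i j); last first.
  apply/funext => p; rewrite /= linear_sum summxE.
  by apply: eq_bigr => s _; rewrite linearZ mxE.
apply: sum_continuous_at => s; apply: continuousM.
  have f1 : {for (x, u), continuous (fst : X * vtop U -> X)} by exact: cvg_fst.
  exact: (continuous_comp f1 (cc s)).
have f2 : {for (x, u), continuous (snd : X * vtop U -> vtop U)} by exact: cvg_snd.
have c2 := continuous_comp f2 (@linear_continuous _ _ _ _ (toU_linear s) _).
have c3 : {for toU u s, continuous (v2r : vtop U -> 'rV[K]_(dim U))}.
  exact: initial_continuous.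
have c4 := continuous_comp c2 c3.
exact: (continuous_comp c4 (@coord_continuous K _ _ i j _)).
Qed.

End GroupAlgebraAction.

(** * Trivialising a quotient bundle *)

Section Trivialisation.
Variables (K : numFieldType) (aT : finGroupType) (X : topologicalType).
Variables (toX : {action aT &-> X}) (U : vectType K) (toU : {action aT &-> U}).
Hypothesis toU_linear : forall s, linear (toU^~ s).
Hypothesis toX_continuous : forall s, continuous (toX^~ s).
Hypothesis toX_free : forall x s, toX x s = x -> s = 1%g.
Hypothesis X_separated : hausdorff_space X.
Variable f : X -> K.
Hypothesis f_continuous : continuous f.
Local Notation N := #|{: aT}|.

(** The matrix of the right multiplication by [sum_s f (x s) s] in the group algebra,
    up to a permutation of its columns.  The inverse turns the right action [toX]
    into a left one, which for configurations is [x \o s]. *)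
Definition translates_mx x : 'M[K]_N :=
  \matrix_(r < N, k < N) f (toX x ((enum_val k : aT) * enum_val r)^-1%g).
Hypothesis translates_unit : forall x, translates_mx x \in unitmx.

(* The family [op (c x)] trivialises the bundle, with inverse [op (d x)]. *)
Let c x s := f (toX x s).
(* A row of the inverse matrix is a one-sided inverse in the group algebra, which
   [coframeK] shows to be two-sided. *)
Let d x s := invmx (translates_mx x) (enum_rank (1%g : aT)) (enum_rank s).

Lemma frame_continuous s : continuous (fun x => c x s).
Proof. by move=> x; exact: (continuous_comp (@toX_continuous s x) (@f_continuous _)). Qed.

Lemma coframe_continuous s : continuous (fun x => d x s).
Proof.
move=> x; apply: invmx_continuous_at => // i j.
rewrite (_ : (fun t => _) = fun t => c t ((enum_val j : aT) * enum_val i)^-1%g).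
  exact: frame_continuous.
by apply/funext => t; rewrite mxE.
Qed.

Local Notation op := (galg_act toU).

Lemma frameK x u : op (c x) (op (d x) u) = u.
Proof.
rewrite galg_actM // galg_act1 // => r.
have := congr1 (fun M : 'M_N => M (enum_rank (1%g : aT)) (enum_rank r^-1%g))
  (mulVmx (translates_unit x)).
rewrite /= !mxE (inj_eq enum_rank_inj) eq_sym eq_invg1 => <-.
rewrite [RHS](reindex _ (onW_bij _ (@enum_rank_bij aT))) /=.
by apply: eq_bigr => t _; rewrite mxE !enum_rankK invMg invgK.
Qed.

Lemma coframeK x u : op (d x) (op (c x) u) = u.
Proof.
(* The corresponding column gives an inverse on the other side. *)
pose d' s := invmx (translates_mx x) (enum_rank s) (enum_rank (1%g : aT)).
have d'c v : op d' (op (c x) v) = v.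
  rewrite galg_actM // galg_act1 // => r.
  have := congr1 (fun M : 'M_N => M (enum_rank r^-1%g) (enum_rank (1%g : aT)))
    (mulmxV (translates_unit x)).
  rewrite /= !mxE (inj_eq enum_rank_inj) eq_invg1 => <-.
  rewrite (reindex_inj (inj_comp (mulgI r) invg_inj)).
  rewrite [RHS](reindex _ (onW_bij _ (@enum_rank_bij aT))) /=.
  by apply: eq_bigr => t _; rewrite mxE !enum_rankK !invMg !invgK mulgKV.
by rewrite -[op (d x) _]d'c frameK d'c.
Qed.

Let E := quotient_bundle toU_linear toX_continuous toX_free X_separated.
Let B : topologicalType := orbit_space toX.
Local Notation diag := (diag_action toX toU).

Let to_prod (e : orbit_space diag) : B * vtop U :=
  (orbit_pi toX (orbit_repr e).1, op (c (orbit_repr e).1) (orbit_repr e).2).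
Let of_prod (p : B * vtop U) : orbit_space diag :=
  orbit_pi diag (orbit_repr p.1, op (d (orbit_repr p.1)) p.2).

(** The family [op (c x)] is constant on the orbits of the diagonal action, so that it
    maps the quotient bundle to the product bundle. *)
Lemma frame_act x u s : op (c (toX x s)) (toU u s) = op (c x) u.
Proof.
rewrite /galg_act [RHS](reindex_inj (mulgI s)) /=.
by apply: eq_bigr => t _; rewrite /c !total_actM.
Qed.

Lemma coframe_act x v s : op (d (toX x s)) v = toU (op (d x) v) s.
Proof. by rewrite -[RHS](coframeK (toX x s)) frame_act frameK. Qed.

Lemma to_prod_pi p : to_prod (orbit_pi diag p) = (orbit_pi toX p.1, op (c p.1) p.2).
Proof.
rewrite /to_prod; have [s ->] := orbit_repr_pi diag p.
by rewrite /= orbit_pi_act frame_act.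
Qed.

Lemma of_prod_pi x v : of_prod (orbit_pi toX x, v) = orbit_pi diag (x, op (d x) v).
Proof.
rewrite /of_prod /=; have [s ->] := orbit_repr_pi toX x.
by rewrite coframe_act; apply/esym/orbit_piP; exists s.
Qed.

(** If the translates of some continuous function [f] are linearly independent on every
    orbit, the bundles attached to all representations of the group are trivial. *)
Lemma quotient_bundle_trivial : topologically_trivial E.
Proof.
exists U, to_prod, of_prod; split.
- move=> e; rewrite -[e]orbit_reprK; case: (orbit_repr e) => x u.
  apply: orbit_continuous_at; first exact: diag_action_continuous.
  rewrite (_ : _ \o _ = fun p : X * vtop U => (orbit_pi toX p.1, op (c p.1) p.2 : vtop U)).
    have f1 : {for (x, u), continuous (fst : X * vtop U -> X)} by exact: cvg_fst.
    have c1 := continuous_comp f1 (@orbit_pi_continuous _ _ toX _).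
    have c2 := @galg_act_continuous_at _ _ _ _ toU_linear _ c x u
      (fun s => @frame_continuous s x).
    exact: (cvg_pair c1 c2).
  by apply/funext => p; exact: to_prod_pi.
- move=> [b v]; rewrite -[b]orbit_reprK; set x := orbit_repr b.
  apply: orbit_continuous2_at => //.
  rewrite (_ : (fun p => _) = fun p : X * vtop U =>
      orbit_pi diag (p.1, op (d p.1) p.2)).
    have f1 : {for (x, v), continuous (fst : X * vtop U -> X)} by exact: cvg_fst.
    have c2 := @galg_act_continuous_at _ _ _ _ toU_linear _ d x v
      (fun s => @coframe_continuous s x).
    have cp : {for (x, v), continuous (fun p : X * vtop U =>
      (p.1, op (d p.1) p.2) : X * vtop U)} by exact: (cvg_pair f1 c2).
    exact: (continuous_comp cp (@orbit_pi_continuous _ _ diag _)).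
  by apply/funext => p; exact: of_prod_pi.
- move=> e; rewrite -[e]orbit_reprK; case: (orbit_repr e) => x u.
  by rewrite to_prod_pi of_prod_pi /= coframeK.
- move=> [b v]; rewrite -[b]orbit_reprK.
  by rewrite of_prod_pi to_prod_pi /= frameK.
split=> [e //|b].
pose L : {linear U -> U} := HB.pack (op (c (orbit_repr b)))
  (GRing.isLinear.Build _ _ _ _ _ (@galg_act_linear _ _ _ _ toU_linear (c (orbit_repr b)))).
exists L => u.
by rewrite /= /quotient_fibre_in to_prod_pi /= orbit_reprK.
Qed.

End Trivialisation.

Lemma poly_fn_continuous (K : numFieldType) n (T : topologicalType)
    (g : T -> 'I_n -> K) (p : ('I_n -> K) -> K) :
  (forall i, continuous (fun t => g t i)) -> poly_fn p ->
  continuous (fun t => p (g t)).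
Proof.
move=> cg; elim=> [|c a q [k ->] _ IH] t; first exact: cst_continuous.
apply: continuousD (IH t); apply: continuousM; first exact: cst_continuous.
apply: prod_continuous_at => i.
have -> : (fun t0 => g t0 i ^+ a i) = (fun t0 => \prod_(j < a i) g t0 i).
  by apply/funext => t0; rewrite prodr_const card_ord.
by apply: prod_continuous_at => j; exact: cg.
Qed.

(** * Knizhnik-Zamolodchikov bundles *)

Theorem theorem1p1 (R : realType) (n : nat) (n_ge1 : (1 <= n)%N)
    (U : vectType (complexes R)) (rho : {action 'S_n &-> U})
    (rho_linear : forall s : 'S_n, linear (fun u : U => rho u s)) :
  topologically_trivial (KZ_bundle rho_linear).
Proof.
have [p pp pU] := group_determinant (complexes R) n.
pose coord (z : config_space R n) : 'I_n -> complexes R := (\val z) 0.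
apply: (@quotient_bundle_trivial _ _ _ _ _ _ _ _ _ _ (fun z => p (coord z))).
  by apply: poly_fn_continuous => // i; exact: config_coord_continuous.
move=> z; have zi : injective (coord z) := set_mem (valP z).
rewrite (_ : translates_mx _ _ _ = \matrix_(r, k)
    p ((coord z \o (enum_val r : 'S_n)) \o (enum_val k : 'S_n))).
  exact: pU.
apply/matrixP => r k; rewrite !mxE; congr p.
by apply/funext => i; rewrite /coord /= mxE invgK permM.
Qed.
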